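(* Let $\mathbb{F}$ be $\mathbb{R}$ or $\mathbb{C}$, and let $\{\varphi_j\}_{j=1}^{n}$ be an equiangular tight frame (ETF) for a Hilbert space over $\mathbb{F}$ of dimension $d<n$, scaled so that $\|\varphi_j\|^2=s$ for all $j$, where $s=\left[\frac{d(n-1)}{n-d}\right]^{1/2}$. Then for any $(s+1)$-element subset $\mathcal{K}$ of $\{1,\dots,n\}$, $\{\varphi_j\}_{j\in\mathcal{K}}$ is a regular simplex if and only if $$\langle\varphi_{j_1},\varphi_{j_2}\rangle\langle\varphi_{j_2},\varphi_{j_3}\rangle\langle\varphi_{j_3},\varphi_{j_1}\rangle=-1$$ for all pairwise-distinct $j_1,j_2,j_3\in\mathcal{K}$. Moreover, in this case a sequence of scalars $\{c_j\}_{j\in\mathcal{K}}$ in $\mathbb{F}$ is a Naimark complement for $\{\varphi_j\}_{j\in\mathcal{K}}$ if and only if $$\sum_{j\in\mathcal{K}}\overline{c_j}\,\varphi_j=0\quad\text{and}\quad |c_j|=1\ \text{ for all } j\in\mathcal{K}.$$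
   Context: Inner products are conjugate-linear in the first argument. A finite sequence $\{\varphi_j\}_{j=1}^n$ of nonzero vectors in a Hilbert space $\mathbb{H}$ is an ETF for $\mathbb{H}$ if $\|\varphi_j\|$ is constant over $j$, $|\langle\varphi_j,\varphi_{j'}\rangle|$ is constant over all $j\neq j'$, and it is an $a$-tight frame for $\mathbb{H}$ for some $a>0$, meaning $\sum_{j=1}^n\langle\varphi_j,y\rangle\varphi_j=ay$ for all $y\in\mathbb{H}$. For a positive integer $s$, a regular $s$-simplex is a sequence of $s+1$ vectors that is an ETF for its span, where this span has dimension $s$; a regular simplex is a regular $s$-simplex for some $s$. If $\{\varphi_j\}_{j\in\mathcal{J}}$ (with $\mathcal{J}$ finite) is an $a$-tight frame for its span and this span has dimension less than $\#\mathcal{J}$, a Naimark complement of it is a sequence $\{\psi_j\}_{j\in\mathcal{J}}$ of vectors in a Hilbert space over $\mathbb{F}$ whose Gram matrix satisfies $\Psi^*\Psi=a\mathbf{I}-\Phi^*\Phi$, where $(\Phi^*\Phi)(j,j')=\langle\varphi_j,\varphi_{j'}\rangle$ and $(\Psi^*\Psi)(j,j')=\langle\psi_j,\psi_{j'}\rangle$. Scalars are regarded as vectors in the one-dimensional Hilbert space $\mathbb{F}$, with $\langle c,c'\rangle=\overline{c}c'$. *)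

(* Defs.v *)
From HB Require Import structures.
From mathcomp Require Import all_boot all_order all_algebra.
From mathcomp Require Import complex.
From mathcomp Require Import reals.

Set Implicit Arguments.
Unset Strict Implicit.
Unset Printing Implicit Defensive.

Import Order.TTheory GRing.Theory Num.Theory.
Local Open Scope ring_scope.

Variant scalar_kind := RealScalars | ComplexScalars.

Definition scalars (R : realType) (k : scalar_kind) : numFieldType :=
  match k with
  | RealScalars => R
  | ComplexScalars => R[i]
  end.

Definition sconj (R : realType) (k : scalar_kind) :
    {rmorphism scalars R k -> scalars R k} :=
  match k return {rmorphism scalars R k -> scalars R k} with
  | RealScalars => idfun
  | ComplexScalars => @conjc R
  end.

Definition sRe (R : realType) (k : scalar_kind) : scalars R k -> R :=
  match k return scalars R k -> R with
  | RealScalars => id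
  | ComplexScalars => @complex.Re R
  end.

Lemma sconjK (R : realType) (k : scalar_kind) : involutive (sconj R k).
Proof. by case: k => //; exact: conjcK. Qed.

Lemma mul_sconj (R : realType) (k : scalar_kind) (x : scalars R k) :
  x * sconj R k x = `|x| ^+ 2.
Proof.
case: k x => /= x; first by rewrite real_normK ?num_real.
by rewrite sqr_normc.
Qed.

(* A Hilbert space is a finite-dimensional vector space V with a positive
   definite form; completeness is automatic.  Library forms {dot V for _} are
   linear in their first argument, so the inner product, which is
   conjugate-linear in its first argument, swaps the two. *)
Definition inner (R : realType) (k : scalar_kind) (V : vectType (scalars R k))
    (dot : {dot V for sconj R k}) (x y : V) : scalars R k := dot y x.

Definition hnorm (R : realType) (k : scalar_kind) (V : vectType (scalars R k))
    (dot : {dot V for sconj R k}) (x : V) : R :=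
  Num.sqrt (sRe (inner dot x x)).

Definition scalar_dot (R : realType) (k : scalar_kind)
  (x y : (scalars R k)^o) : scalars R k := x * sconj R k y.
Arguments scalar_dot : clear implicits.

Section ScalarDot.
Variables (R : realType) (k : scalar_kind).
Local Notation F := (scalars R k).

Let dot_l (y : F^o) : zmod_morphism (scalar_dot R k ^~ y).
Proof. by move=> u v; rewrite /scalar_dot mulrBl. Qed.
Let dot_r (x : F^o) : zmod_morphism (scalar_dot R k x).
Proof. by move=> u v; rewrite /scalar_dot rmorphB mulrBr. Qed.
Let dot_Zl (y : F^o) : scalable_for *%R (scalar_dot R k ^~ y).
Proof. by move=> a u; rewrite /scalar_dot -mulrA. Qed.
Let dot_Zr (x : F^o) : scalable_for (sconj R k \; *%R) (scalar_dot R k x).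
Proof. by move=> a u; rewrite /scalar_dot /= rmorphM mulrCA. Qed.
Let dot_herm (x y : F^o) :
  scalar_dot R k x y = (-1) ^+ false * sconj R k (scalar_dot R k y x).
Proof. by rewrite /scalar_dot expr0 mul1r rmorphM sconjK mulrC. Qed.
Let dot_gt0 (x : F^o) : x != 0 -> 0 < scalar_dot R k x x.
Proof. by move=> x0; rewrite /scalar_dot mul_sconj exprn_gt0 // normr_gt0. Qed.

HB.instance Definition _ :=
  isBilinear.Build F F^o F^o F *%R (sconj R k \; *%R) (scalar_dot R k)
    dot_l dot_r dot_Zl dot_Zr.
HB.instance Definition _ :=
  isHermitianSesquilinear.Build F F^o false (sconj R k) (scalar_dot R k)
    dot_herm.
HB.instance Definition _ :=
  isDotProduct.Build F F^o (scalar_dot R k) dot_gt0.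
End ScalarDot.

Lemma scalar_innerE (R : realType) (k : scalar_kind) (c c' : (scalars R k)^o) :
  inner (scalar_dot R k) c c' = sconj R k c * c'.
Proof. by rewrite /inner /= /scalar_dot mulrC. Qed.

Section Frames.
Variables (R : realType) (k : scalar_kind) (V : vectType (scalars R k)).
Variables (dot : {dot V for sconj R k}) (J : finType).
Implicit Types (phi : J -> V) (W : {vspace V}).
Local Notation "<< x , y >>" := (inner dot x y).

(* In R[i] the order is that of numDomainType, so 0 < a makes a real. *)
Definition tight_frame_for W phi (a : scalars R k) : Prop :=
  [/\ 0 < a, forall j, phi j \in W &
      forall y, y \in W -> \sum_j <<phi j, y>> *: phi j = a *: y].

Definition etf_for W phi : Prop :=
  [/\ forall j, phi j != 0,
      forall i j, hnorm dot (phi i) = hnorm dot (phi j),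
      forall i j i' j', i != j -> i' != j' ->
        `|<<phi i, phi j>>| = `|<<phi i', phi j'>>| &
      exists a, tight_frame_for W phi a].

Definition fspan phi : {vspace V} := <<codom phi>>%VS.

Definition regular_simplex_dim phi (s : nat) : Prop :=
  [/\ (0 < s)%N, #|J| = s.+1, etf_for (fspan phi) phi & \dim (fspan phi) = s].

Definition regular_simplex phi : Prop := exists s, regular_simplex_dim phi s.

Definition gram phi (i j : J) : scalars R k := <<phi i, phi j>>.

End Frames.

Definition naimark_complement (R : realType) (k : scalar_kind)
    (V U : vectType (scalars R k)) (dotV : {dot V for sconj R k})
    (dotU : {dot U for sconj R k}) (J : finType)
    (phi : J -> V) (psi : J -> U) : Prop :=
  exists a, [/\ tight_frame_for dotV (fspan phi) phi a,
    (\dim (fspan phi) < #|J|)%N &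
    forall i j, gram dotU psi i j = a * (i == j)%:R - gram dotV phi i j].

Definition subfamily (I : finType) (T : Type) (K : {set I}) (f : I -> T) :
  {j : I | j \in K} -> T := fun j => f (val j).
Arguments subfamily {I T} K f _ /.

(* Main.v *)
Require Import Defs.
From HB Require Import structures.
From mathcomp Require Import all_boot all_order all_algebra.
From mathcomp Require Import complex.
From mathcomp Require Import boolp reals.
From mathcomp Require Import ring.

Set Implicit Arguments.
Unset Strict Implicit.
Unset Printing Implicit Defensive.

Import Order.TTheory GRing.Theory Num.Theory.
Local Open Scope ring_scope.

(** Write m for the cardinality of K and let N = m I - G, where G is the Gram
    matrix of the family indexed by K.

    The scaling makes N unimodular.  Taking the trace of the frame identity and
    testing it on one vector gives the Welch equality ([welch_equality]): for
    norms sqrt s, the common value of |<phi_i, phi_j>|^2 is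
    s^2 (n - d) / (d (n - 1)), which is 1 for the prescribed s.  As m = s + 1,
    every diagonal entry of N is 1 and every other entry has modulus 1.

    Everything then follows from one rigidity fact ([dependency_cogram]).  A
    dependency sum_j x_j phi_j = 0 means N x = m x, so m x_i is a sum of the m
    terms N_ij x_j, of moduli |x_j|.  The total squared deviation of these terms
    from their means x_i is m ||x||^2 - m ||x||^2 = 0, hence N_ij x_j = x_i
    throughout.  So the family is dependent exactly when N = x x^* for some
    unimodular x, which is again equivalent to N_ij N_jl N_li = 1 for all i, j, l
    (given these equations, a column of N serves as x): off the diagonal N = - G,
    and this is the condition on triple products.

    A regular simplex is dependent by its dimension.  Conversely, N = x x^* and
    sum_j x_j phi_j = 0 make the family m-tight for its span
    ([dependency_tight]), and the trace forces the span to have dimension m - 1.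
    Finally, a sequence of scalars c is a Naimark complement exactly when
    conj(c_i) c_j = N_ij, that is, when x = conj(c) is such a unimodular
    dependency. *)

(** * Scalars *)

Section Scalars.
Variables (R : realType) (k : scalar_kind).
Implicit Types x y : scalars R k.

Lemma sRe_nat x m : 0 <= x -> sRe x = m%:R -> x = m%:R.
Proof.
case: k x => //= -[a b]; rewrite lecE /= => /andP[/eqP b0 _] a_m.
by rewrite -[RHS](rmorph_nat (real_complex R)) /real_complex_def /= -a_m b0.
Qed.

Lemma sRe_ge0 x : 0 <= x -> 0 <= sRe x.
Proof. by case: k x => //= -[a b]; rewrite lecE /= => /andP[]. Qed.

Lemma norm1_mul_sconj x : `|x| = 1 -> x * sconj R k x = 1.
Proof. by rewrite mul_sconj => ->; rewrite expr1n. Qed.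

Lemma mul_sconj_norm1 x : x * sconj R k x = 1 -> `|x| = 1.
Proof.
by move/eqP; rewrite mul_sconj sqrf_eq1 => /orP[/eqP//|/eqP x_N1];
  have := normr_ge0 x; rewrite x_N1 ler0N1.
Qed.

Lemma norm_sconj x : `|sconj R k x| = `|x|.
Proof. by apply/eqP; rewrite -(@eqrXn2 _ 2) // -!mul_sconj sconjK mulrC. Qed.

(** The expansion of |u x - y|^2 in which the factor u, being unimodular,
    disappears from the first square. *)
Lemma norm_subM_sqr (u x y : scalars R k) : `|u| = 1 ->
  `|u * x - y| ^+ 2 =
    `|x| ^+ 2 - u * x * sconj R k y - y * sconj R k (u * x) + `|y| ^+ 2.
Proof.
move=> u1; have -> : `|x| ^+ 2 = `|u * x| ^+ 2 by rewrite normrM u1 mul1r.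
by rewrite -!mul_sconj rmorphB; ring.
Qed.

End Scalars.

(** * Inner products, tight frames and the Welch equality *)

Section Inner.
Variables (R : realType) (k : scalar_kind) (V : vectType (scalars R k)).
Variable dot : {dot V for sconj R k}.

Lemma innerC x y : inner dot y x = sconj R k (inner dot x y).
Proof. by rewrite /inner hermC expr0 mul1r. Qed.

Lemma innerZr a x y : inner dot x (a *: y) = a * inner dot x y.
Proof. by rewrite /inner linearZl_LR. Qed.

Lemma inner_sumr (J : finType) (y : V) (a : J -> scalars R k) (f : J -> V) :
  inner dot y (\sum_j a j *: f j) = \sum_j a j * inner dot y (f j).
Proof. by rewrite /inner linear_sumlz; apply: eq_bigr => j _; rewrite linearZl_LR. Qed.

Lemma inner_suml (J : finType) (y : V) (a : J -> scalars R k) (f : J -> V) :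
  inner dot (\sum_j a j *: f j) y = \sum_j sconj R k (a j) * inner dot (f j) y.
Proof.
rewrite innerC inner_sumr rmorph_sum; apply: eq_bigr => j _.
by rewrite rmorphM -innerC.
Qed.

Lemma inner_gt0 x : x != 0 -> 0 < inner dot x x.
Proof. exact: neq0_dnorm_gt0. Qed.

Lemma inner_eq0 x : inner dot x x = 0 -> x = 0.
Proof.
by move=> /eqP xx0; apply: contraTeq xx0 => /inner_gt0; rewrite lt0r => /andP[].
Qed.

Lemma inner_ge0 x : 0 <= inner dot x x.
Proof.
have [->|/inner_gt0/ltW//] := eqVneq x 0.
by rewrite /inner linear0r.
Qed.

Lemma hnorm_sqr x : hnorm dot x ^+ 2 = sRe (inner dot x x).
Proof. by rewrite sqr_sqrtr // sRe_ge0 // inner_ge0. Qed.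

Variables (J : finType) (phi : J -> V).

(** The frame operator is a times the identity of W, so its trace is a dim W; it
    is also a sum of operators of rank one, y |-> <phi_j, y> phi_j, whose traces
    are <phi_j, phi_j>.  Both traces are computed in a basis of W. *)
Lemma tight_frame_trace W a : tight_frame_for dot W phi a ->
  \sum_j inner dot (phi j) (phi j) = a * (\dim W)%:R.
Proof.
move=> [_ phiW tightW].
pose e := vbasis W; have e_free : free e := basis_free (vbasisP W).
have eW i : e`_i \in W.
  case: (ltnP i (\dim W)) => iW; last by rewrite nth_default ?size_tuple ?mem0v.
  by apply: vbasis_mem; rewrite mem_nth // size_tuple.
have entry (i : 'I_(\dim W)) :
    \sum_j inner dot (phi j) e`_i * coord e i (phi j) = a.
  have := congr1 (coord e i) (tightW _ (eW i)).
  rewrite linear_sum linearZ /= coord_free // eqxx mulr1 => <-.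
  by apply: eq_bigr => j _; rewrite linearZ.
have -> : a * (\dim W)%:R =
    \sum_(i < \dim W) \sum_j inner dot (phi j) e`_i * coord e i (phi j).
  by rewrite (eq_bigr _ (fun i _ => entry i)) sumr_const card_ord mulr_natr.
rewrite exchange_big; apply: eq_bigr => j _ /=.
rewrite {2}(coord_vbasis (phiW j)) inner_sumr.
by apply: eq_bigr => i _; rewrite mulrC.
Qed.

(** With n vectors, the trace gives n r = a dim W, and pairing the frame identity
    at phi_j0 with phi_j0 gives r^2 + (n - 1) b^2 = a r; eliminating a yields the
    claim. *)
Lemma welch_equality W a r b (j0 : J) :
    tight_frame_for dot W phi a ->
    (forall j, inner dot (phi j) (phi j) = r) ->
    (forall i j, i != j -> `|inner dot (phi i) (phi j)| = b) ->
  (\dim W)%:R * (#|J|%:R - 1) * b ^+ 2 = r ^+ 2 * (#|J|%:R - (\dim W)%:R).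
Proof.
move=> tight_a diag off; have [_ phiW tightW] := tight_a.
have trace : #|J|%:R * r = a * (\dim W)%:R.
  rewrite -(tight_frame_trace tight_a) (eq_bigr _ (fun j _ => diag j)).
  by rewrite sumr_const mulr_natl.
have energy : r ^+ 2 + (#|J|%:R - 1) * b ^+ 2 = a * r.
  have := congr1 (inner dot (phi j0)) (tightW _ (phiW j0)).
  rewrite inner_sumr innerZr diag => <-.
  rewrite (bigD1 j0) //= diag -expr2; congr (_ + _).
  rewrite (eq_bigr (fun=> b ^+ 2)); last first.
    by move=> j j_j0; rewrite (innerC (phi j0) (phi j)) mulrC mul_sconj off 1?eq_sym.
  rewrite sumr_const -[RHS]mulr_natl; congr (_ * _).
  rewrite (cardD1 j0 predT) in_simpl natrD addrAC subrr add0r; congr _%:R.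
  by apply: eq_card => j; rewrite !inE andbT.
apply/subr0_eq.
have -> : (\dim W)%:R * (#|J|%:R - 1) * b ^+ 2 - r ^+ 2 * (#|J|%:R - (\dim W)%:R) =
  (\dim W)%:R * (r ^+ 2 + (#|J|%:R - 1) * b ^+ 2) - r * (#|J|%:R * r) by ring.
by rewrite energy trace; ring.
Qed.

Lemma nth_codom_enum_val (i : 'I_#|J|) : (codom_tuple phi)`_i = phi (enum_val i).
Proof. by rewrite (nth_map (enum_val i)) -?enum_val_nth // -cardE. Qed.

Lemma sum_enum_rank (x : 'I_#|J| -> scalars R k) :
  \sum_i x i *: (codom_tuple phi)`_i = \sum_j x (enum_rank j) *: phi j.
Proof.
rewrite (reindex (@enum_rank J)); last by apply: onW_bij; exact: enum_rank_bij.
by apply: eq_bigr => j _; rewrite nth_codom_enum_val enum_rankK.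
Qed.

Lemma mem_fspan y : y \in fspan phi ->
  exists x : J -> scalars R k, y = \sum_j x j *: phi j.
Proof.
move=> /(coord_span (X := codom_tuple phi)) y_sum.
by eexists; rewrite [LHS]y_sum sum_enum_rank.
Qed.

Lemma dim_fspan_ltn : (\dim (fspan phi) < #|J|)%N ->
  exists x : J -> scalars R k, (exists j, x j != 0) /\ \sum_j x j *: phi j = 0.
Proof.
move=> dim_lt; have : ~~ free (codom_tuple phi).
  by rewrite /free size_tuple neq_ltn dim_lt.
apply: contraNP => no_x; apply/freeP => x x0 i.
apply/eqP/negPn/negP => x_i; apply: no_x.
exists (fun j => x (enum_rank j)); rewrite -sum_enum_rank; split=> //.
by exists (enum_val i); rewrite enum_valK.
Qed.

End Inner.

(** * Families whose matrix m I - G is unimodular *)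

Section CoGram.
Variables (R : realType) (k : scalar_kind) (V : vectType (scalars R k)).
Variables (dot : {dot V for sconj R k}) (J : finType) (phi : J -> V).
Local Notation m := (#|J|%:R : scalars R k).
Implicit Types x : J -> scalars R k.

(** The Gram matrix that a Naimark complement must have when the frame bound is
    the number of vectors. *)
Definition cogram (i j : J) : scalars R k :=
  m * (i == j)%:R - gram dot phi i j.

Lemma gramE i j : gram dot phi i j = m * (i == j)%:R - cogram i j.
Proof. by rewrite /cogram subKr. Qed.

Lemma cogramC i j : cogram j i = sconj R k (cogram i j).
Proof.
by rewrite /cogram /gram rmorphB rmorphM !rmorph_nat -innerC eq_sym.
Qed.

Lemma inner_dependency x i :
  inner dot (phi i) (\sum_j x j *: phi j) = m * x i - \sum_j cogram i j * x j.
Proof.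
rewrite inner_sumr; under eq_bigr => j _.
  rewrite -/(gram dot phi i j) gramE mulrBr mulrCA (mulrC (x j) (cogram i j)).
  over.
rewrite sumrB -mulr_sumr (bigD1 i) //= eqxx mulr1 big1 ?addr0 // => j j_i.
by rewrite eq_sym (negPf j_i) mulr0.
Qed.

Hypothesis cogram_norm1 : forall i j, `|cogram i j| = 1.

(** The vector x is an eigenvector of N for the eigenvalue m, which is the
    largest one that unimodular entries permit.  Hence x_i is the mean of the
    terms N_ij x_j over j, and the squared deviations from these means add up
    to zero over all i and j. *)
Lemma dependency_cogram x : \sum_j x j *: phi j = 0 ->
  forall i j, cogram i j * x j = x i.
Proof.
move=> x0.
have eigen i : \sum_j cogram i j * x j = m * x i.
  by apply/esym/subr0_eq; rewrite -inner_dependency x0 /inner linear0l.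
pose gap i j := `|cogram i j * x j - x i| ^+ 2.
(* The sum of squared deviations from a mean is the sum of squares minus m
   times the square of the mean. *)
have row_gap i : \sum_j gap i j = (\sum_j `|x j| ^+ 2) - m * `|x i| ^+ 2.
  under eq_bigr => j _ do rewrite /gap norm_subM_sqr //.
  rewrite big_split /= !sumrB sumr_const -mulr_suml -mulr_sumr -rmorph_sum eigen.
  by rewrite rmorphM rmorph_nat -mulr_natl -!mul_sconj; ring.
have gap_ge0 i j : 0 <= gap i j by rewrite exprn_ge0.
have gap0 : \sum_i \sum_j gap i j = 0.
  under eq_bigr => i _ do rewrite row_gap.
  by rewrite sumrB sumr_const -mulr_sumr mulr_natl subrr.
move=> i j; apply/subr0_eq/eqP; rewrite -normr_eq0 -sqrf_eq0 -/(gap i j).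
have gap_i : \sum_j gap i j = 0.
  by apply: (psumr_eq0P _ gap0) => // l _; apply: sumr_ge0.
by apply/eqP; apply: (psumr_eq0P _ gap_i).
Qed.

Lemma dependency_triple x : \sum_j x j *: phi j = 0 -> (exists j, x j != 0) ->
  forall i j l, cogram i j * cogram j l * cogram l i = 1.
Proof.
move=> /dependency_cogram cx [j0 x_j0] i j l.
have x_neq0 : x i != 0.
  by have := x_j0; rewrite -(cx j0 i) mulf_eq0 => /norP[].
by apply: (mulIf x_neq0); rewrite mul1r -!mulrA !cx.
Qed.

Lemma dependency_rank1 x : \sum_j x j *: phi j = 0 -> (forall j, `|x j| = 1) ->
  forall i j, cogram i j = x i * sconj R k (x j).
Proof.
move=> /dependency_cogram cx x1 i j.
by rewrite -(cx i j) -mulrA norm1_mul_sconj ?mulr1.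
Qed.

(** For N = x x^* the eigenvalue equation N x = m x holds, so the combination is
    orthogonal to every vector of the family, hence to itself. *)
Lemma rank1_dependency x : (forall j, `|x j| = 1) ->
  (forall i j, cogram i j = x i * sconj R k (x j)) -> \sum_j x j *: phi j = 0.
Proof.
move=> x1 c_x; apply: (inner_eq0 (dot := dot)).
rewrite inner_suml big1 // => i _; rewrite inner_dependency.
under eq_bigr => j _.
  by rewrite c_x -mulrA [sconj R k _ * _]mulrC norm1_mul_sconj // mulr1 over.
by rewrite sumr_const mulr_natl subrr mulr0.
Qed.

(** Trivial triple products say that N is a coboundary, N_ij = x_i / x_j, with x
    any of its columns. *)
Lemma triple_dependency : (0 < #|J|)%N ->
  (forall i j l, cogram i j * cogram j l * cogram l i = 1) ->
  exists2 x, \sum_j x j *: phi j = 0 & forall j, `|x j| = 1.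
Proof.
move=> /card_gt0P[j0 _] triple; exists (cogram^~ j0) => //.
apply: rank1_dependency => // i j; rewrite -cogramC.
have inv p q : cogram p q * cogram q p = 1 by rewrite (cogramC p q) norm1_mul_sconj.
rewrite -[LHS]mulr1 -(inv j j0) mulrA -[LHS]mulr1 -(inv j0 i).
by rewrite mulrACA triple mul1r mulrC.
Qed.

(** As G = m I - x x^*, the frame operator sends y to m y minus a multiple of
    sum_j x_j phi_j, which vanishes. *)
Lemma dependency_tight x : (0 < #|J|)%N -> \sum_j x j *: phi j = 0 ->
  (forall j, `|x j| = 1) -> tight_frame_for dot (fspan phi) phi m.
Proof.
move=> J_gt0 x0 x1; have c_x := dependency_rank1 x0 x1.
split=> [|j|y]; first by rewrite ltr0n.
  by apply: memv_span; exact: codom_f.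
case/mem_fspan => b ->.
have inner_phi j :
    inner dot (phi j) (\sum_l b l *: phi l) =
      m * b j - x j * \sum_l sconj R k (x l) * b l.
  rewrite inner_dependency; congr (_ - _); rewrite mulr_sumr; apply: eq_bigr => l _.
  by rewrite c_x mulrA.
under eq_bigr => j _ do rewrite inner_phi scalerBl [x j * _]mulrC -!scalerA.
by rewrite sumrB -!scaler_sumr x0 scaler0 subr0.
Qed.

End CoGram.

(** * Regular simplices *)

Section Simplex.
Variables (R : realType) (k : scalar_kind) (V : vectType (scalars R k)).
Variables (dot : {dot V for sconj R k}) (J : finType) (phi : J -> V).
Local Notation m := (#|J|%:R : scalars R k).

Hypothesis J_gt1 : (1 < #|J|)%N.
Hypothesis norm_phi : forall j, inner dot (phi j) (phi j) = m - 1.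
Hypothesis angle_phi : forall i j, i != j -> `|inner dot (phi i) (phi j)| = 1.

Let J_gt0 : (0 < #|J|)%N. Proof. exact: ltnW. Qed.

Lemma cogram_diag i : cogram dot phi i i = 1.
Proof. by rewrite /cogram /gram eqxx mulr1 norm_phi subKr. Qed.

Lemma cogram_off i j : i != j -> cogram dot phi i j = - inner dot (phi i) (phi j).
Proof. by move=> /negPf i_j; rewrite /cogram i_j mulr0 sub0r. Qed.

Lemma cogram_norm i j : `|cogram dot phi i j| = 1.
Proof.
have [->|i_j] := eqVneq i j; first by rewrite cogram_diag normr1.
by rewrite cogram_off // normrN angle_phi.
Qed.

(** Two opposite entries of N multiply to 1, so triple products with a repeated
    index are automatically 1; the others are three sign changes away from those
    of G. *)
Lemma triple_cogramP :
  (forall i j l, cogram dot phi i j * cogram dot phi j l * cogram dot phi l i = 1)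
  <-> (forall i j l, i != j -> j != l -> i != l ->
        inner dot (phi i) (phi j) * inner dot (phi j) (phi l)
          * inner dot (phi l) (phi i) = -1).
Proof.
have inv p q : cogram dot phi p q * cogram dot phi q p = 1.
  by rewrite (cogramC _ _ p q) norm1_mul_sconj // cogram_norm.
split=> triple i j l; last first.
  have [->|i_j] := eqVneq i j; first by rewrite cogram_diag mul1r inv.
  have [->|j_l] := eqVneq j l; first by rewrite cogram_diag mulr1 inv.
  have [->|i_l] := eqVneq i l; first by rewrite cogram_diag mulr1 inv.
  by rewrite !cogram_off // 1?eq_sym // mulrNN mulrN triple // opprK.
move=> i_j j_l i_l; have := triple i j l.
by rewrite !cogram_off // 1?eq_sym // mulrNN mulrN => <-; rewrite opprK.
Qed.

Lemma trace_simplex W a : tight_frame_for dot W phi a ->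
  m * (m - 1) = a * (\dim W)%:R.
Proof.
move=> /tight_frame_trace <-.
by rewrite (eq_bigr _ (fun j _ => norm_phi j)) sumr_const mulr_natl.
Qed.

(** The family is m-tight, so by the trace m (m - 1) is m times the dimension of
    the span. *)
Lemma dependency_dim (x : J -> scalars R k) :
  \sum_j x j *: phi j = 0 -> (forall j, `|x j| = 1) -> #|J| = (\dim (fspan phi)).+1.
Proof.
move=> x0 x1.
have /trace_simplex := dependency_tight cogram_norm J_gt0 x0 x1.
have m_neq0 : m != 0 by rewrite pnatr_eq0 -lt0n.
by move=> /(mulfI m_neq0)/eqP; rewrite subr_eq natr1 eqr_nat => /eqP ->.
Qed.

(** A simplex has one vector more than its dimension, so some dependency exists,
    and rigidity trivializes the triple products of N; a column of N is then a
    unimodular dependency. *)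
Lemma regular_simplexP : regular_simplex dot phi <->
  exists2 x : J -> scalars R k,
    \sum_j x j *: phi j = 0 & forall j, `|x j| = 1.
Proof.
split=> [[s [_ cardJ _ dim_s]]|[x x0 x1]].
  have [|x [x_neq0 x0]] := @dim_fspan_ltn _ _ _ _ phi; first by rewrite dim_s cardJ.
  apply: (triple_dependency cogram_norm J_gt0).
  exact: (dependency_triple cogram_norm x0 x_neq0).
have cardJ := dependency_dim x0 x1.
exists (\dim (fspan phi)); split=> //; first by rewrite -ltnS -cardJ.
split.
- move=> j; apply: contraTneq J_gt1 => phi0.
  have := norm_phi j; rewrite phi0 /inner linear0l => /esym/eqP.
  by rewrite subr_eq0 pnatr_eq1 => /eqP ->.
- by move=> i j; rewrite /hnorm !norm_phi.
- by move=> i j i' j' ij ij'; rewrite !angle_phi.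
- by exists m; apply: (dependency_tight cogram_norm J_gt0 x0 x1).
Qed.

Lemma regular_simplex_tripleP : regular_simplex dot phi <->
  forall i j l, i != j -> j != l -> i != l ->
    inner dot (phi i) (phi j) * inner dot (phi j) (phi l)
      * inner dot (phi l) (phi i) = -1.
Proof.
rewrite regular_simplexP -triple_cogramP; split=> [[x x0 x1]|]; last first.
  exact: triple_dependency cogram_norm J_gt0.
have /card_gt0P[j0 _] := J_gt0.
apply: (dependency_triple cogram_norm x0); exists j0.
by rewrite -normr_eq0 x1 oner_eq0.
Qed.

(** The trace forces the frame bound to be m, so the condition on the Gram matrix
    of c reads conj(c_i) c_j = N_ij. *)
Lemma naimark_simplexP (c : J -> scalars R k) : regular_simplex dot phi ->
  naimark_complement dot (scalar_dot R k) phi c <->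
  \sum_j sconj R k (c j) *: phi j = 0 /\ forall j, `|c j| = 1.
Proof.
move=> [s [s_gt0 cardJ _ dim_s]]; split=> [[a [tight_a _ gram_c]]|[c0 c1]].
  have a_m : a = m.
    have := trace_simplex tight_a; rewrite dim_s cardJ -natr1 addrK.
    by move/mulIf=> -> //; rewrite pnatr_eq0 -lt0n.
  have c_cogram i j : sconj R k (c i) * c j = cogram dot phi i j.
    by rewrite -scalar_innerE -/(gram _ _ _ _) gram_c a_m.
  have c1 j : `|c j| = 1.
    by apply: mul_sconj_norm1; rewrite mulrC c_cogram cogram_diag.
  split=> //; apply: (rank1_dependency (dot := dot)) => [j|i j].
    by rewrite norm_sconj.
  by rewrite sconjK c_cogram.
have cs1 j : `|sconj R k (c j)| = 1 by rewrite norm_sconj.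
exists m; split; first exact: (dependency_tight cogram_norm J_gt0 c0 cs1).
  by rewrite dim_s cardJ.
move=> i j; rewrite /gram scalar_innerE.
by have := dependency_rank1 cogram_norm c0 cs1 i j; rewrite sconjK.
Qed.

End Simplex.

(** * Simplices in equiangular tight frames *)

Theorem theorem4p2 (R : realType) (k : scalar_kind)
    (V : vectType (scalars R k)) (dot : {dot V for sconj R k})
    (d n : nat) (phi : 'I_n -> V) (s : R)
    (dim_V : \dim {:V} = d) (lt_dn : (d < n)%N)
    (etf_phi : etf_for dot fullv phi)
    (def_s : s = Num.sqrt (d%:R * (n%:R - 1) / (n%:R - d%:R)))
    (norm_phi : forall j, hnorm dot (phi j) ^+ 2 = s)
    (K : {set 'I_n}) (card_K : #|K|%:R = s + 1) :
  (regular_simplex dot (subfamily K phi) <->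
     (forall j1 j2 j3 : 'I_n, j1 \in K -> j2 \in K -> j3 \in K ->
        j1 != j2 -> j2 != j3 -> j1 != j3 ->
        inner dot (phi j1) (phi j2) * inner dot (phi j2) (phi j3)
          * inner dot (phi j3) (phi j1) = -1)) /\
  (regular_simplex dot (subfamily K phi) ->
     forall c : {j : 'I_n | j \in K} -> scalars R k,
       naimark_complement dot (scalar_dot R k) (subfamily K phi) c <->
       (\sum_(j : {j : 'I_n | j \in K}) sconj R k (c j) *: phi (val j) = 0 /\
        forall j, `|c j| = 1)).
Proof.
have n_gt0 : (0 < n)%N by apply: leq_trans lt_dn.
have r_ge0 : 0 <= d%:R * (n%:R - 1) / (n%:R - d%:R) :> R.
  by rewrite divr_ge0 ?mulr_ge0 ?subr_ge0 ?ler1n ?ler_nat ?ler0n ?(ltnW lt_dn).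
pose j0 := Ordinal n_gt0.
have [phi_neq0 _ off_const [a tight_a]] := etf_phi.
have d_gt0 : (0 < d)%N.
  rewrite -dim_V lt0n; apply: contra (phi_neq0 j0) => /eqP dim0.
  have : phi j0 \in fullv by rewrite memvf.
  by move: dim0 => /eqP; rewrite dimv_eq0 => /eqP ->; rewrite memv0.
have K_gt0 : (0 < #|K|)%N.
  by rewrite -(ltr0n R) card_K ltr_wpDl ?ltr01 // def_s sqrtr_ge0.
have s_nat : s = #|K|.-1%:R.
  by apply: (addIr 1); rewrite -card_K natr1 prednK.
(* The definition of s, squared and cleared of denominators. *)
have s_sqr : (#|K|.-1 ^ 2 * (n - d) = d * (n - 1))%N.
  apply/eqP; rewrite -(eqr_nat R) natrM natrX -s_nat natrM !natrB // ?(ltnW lt_dn) //.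
  rewrite {1}def_s sqr_sqrtr // divfK // subr_eq0 eqr_nat.
  by rewrite neq_ltn lt_dn orbT.
(* If s were 0 then so would be d (n - 1), although 0 < d < n. *)
have K_gt1 : (1 < #|K|)%N.
  move: K_gt0 s_sqr; case: #|K| => // -[|//] _ /eqP.
  rewrite /= exp0n // mul0n eq_sym muln_eq0 !eqn0Ngt d_gt0 subn_gt0.
  by rewrite (leq_ltn_trans d_gt0 lt_dn).
have diag j : inner dot (phi j) (phi j) = #|K|.-1%:R.
  by apply: sRe_nat; rewrite ?inner_ge0 // -hnorm_sqr norm_phi.
(* The Welch equality, with s^2 (n - d) replaced by d (n - 1). *)
have angle i j : i != j -> `|inner dot (phi i) (phi j)| = 1.
  move=> i_j; apply/eqP; rewrite -sqrp_eq1 //.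
  have := welch_equality j0 tight_a diag (fun i' j' ij' => off_const i' j' i j ij' i_j).
  rewrite card_ord dim_V -natrX -(natrB _ n_gt0) -(natrB _ (ltnW lt_dn)) -!natrM s_sqr.
  move=> /eqP; rewrite -subr_eq0 -{2}[_%:R]mulr1 -mulrBr mulf_eq0 subr_eq0.
  rewrite pnatr_eq0 muln_eq0 !eqn0Ngt d_gt0 subn_gt0.
  by rewrite (leq_ltn_trans d_gt0 lt_dn).
have card_J : #|{: {j | j \in K}}| = #|K| by rewrite card_sig.
have J_gt1 : (1 < #|{: {j | j \in K}}|)%N by rewrite card_J.
have diag_K (j : {j | j \in K}) :
    inner dot (subfamily K phi j) (subfamily K phi j) = #|{: {j | j \in K}}|%:R - 1.
  by rewrite diag card_J -[in RHS](prednK K_gt0) -natr1 addrK.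
have angle_K (i j : {j | j \in K}) : i != j ->
    `|inner dot (subfamily K phi i) (subfamily K phi j)| = 1.
  by move=> i_j; apply: angle.
split; last by move=> simplex c; apply: naimark_simplexP.
rewrite (regular_simplex_tripleP J_gt1 diag_K angle_K).
split=> [triple i j l iK jK lK|triple i j l]; last first.
  exact: triple (valP i) (valP j) (valP l).
exact: (triple (Sub i iK) (Sub j jK) (Sub l lK)).
Qed.
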